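(* Let $p$ be a prime and let $k,h_1,\ldots,h_l\in\mathbb{Z}^+$ with $k\geqslant\sum_{t=1}^l(p^{h_t}-1)$. Let $c_{st},c_t\in\mathbb{Z}$ for all $s\in[1,k]$, $t\in[1,l]$. Then $$\sum_{\substack{I\subseteq[1,k]\\ p^{h_t}\mid\sum_{s\in I}c_{st}-c_t\ \text{for all}\ t\in[1,l]}}(-1)^{|I|}\equiv\sum_{\substack{I_1\cup\cdots\cup I_l=[1,k]\\ |I_t|=p^{h_t}-1\ \text{for all}\ t\in[1,l]}}\ \prod_{t=1}^l\prod_{s\in I_t}c_{st}\pmod p,$$ where the right-hand sum is over ordered $l$-tuples $(I_1,\ldots,I_l)$ of subsets of $[1,k]$ with union $[1,k]$ and $|I_t|=p^{h_t}-1$ for each $t$.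
   Context: $[1,k]=\{1,\ldots,k\}$. *)

(* Defs.v *)
From mathcomp Require Export all_boot all_order all_algebra.

(* Main.v *)
Require Import Defs.
From mathcomp Require Import all_boot all_order all_algebra.
From mathcomp Require Import mpoly ring.
Import Order.TTheory GRing.Theory Num.Theory.

Local Open Scope ring_scope.

(** Modulo [p], the condition [p^h | x + 1] is detected by [C(x, p^h - 1)]. After
    reducing the [c s t] to natural numbers, the left-hand side is therefore the
    coefficient of [\prod_t X_t^(p^h_t - 1)] in
    [\prod_t (1 + X_t)^(b t) * \prod_s (1 - \prod_t (1 + X_t)^(c s t))].
    Each of the [k] factors of the second product is [- \sum_t c s t X_t] up to
    terms of order 2, so in degree at most [k] this polynomial agrees with
    [(-1)^k \prod_s \sum_t c s t X_t], whose coefficients are sums over maps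
    [s |-> t], that is, over ordered partitions of the index set. When one
    exists, [k = \sum_t (p^h_t - 1)] and the sign is trivial modulo [p]. *)

(** * Binomial coefficients in characteristic [p] *)

Lemma exprD1n_widen (R : nzSemiRingType) (x : R) (n N : nat) :
  (n < N)%N -> (1 + x) ^+ n = \sum_(j < N) x ^+ j *+ 'C(n, j).
Proof.
move=> ltnN; rewrite exprDn_comm; last exact/commr_sym/commr1.
rewrite (big_ord_widen _ (fun j => 1 ^+ (n - j) * x ^+ j *+ 'C(n, j)) ltnN).
rewrite big_mkcond; apply: eq_bigr => j _; rewrite expr1n mul1r ltnS.
by case: leqP => // ltnj; rewrite bin_small.
Qed.

(** In characteristic [p], [(1 + 'X) ^+ (p ^ h) = 1 + 'X^(p ^ h)], and multiplying by this leaves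
    all coefficients of degree below [p ^ h] unchanged. *)
Lemma bin_pchar_add (R : comNzRingType) (p h d y : nat) :
  p \in [pchar R] ->
  'C(d * p ^ h + y, p ^ h - 1)%:R = 'C(y, p ^ h - 1)%:R :> R.
Proof.
move=> charRp; have p_pr := pcharf_prime charRp.
have q_gt0: (0 < p ^ h)%N by rewrite expn_gt0 prime_gt0.
have coef_binom n i : ((1 + 'X) ^+ n : {poly R})`_i = 'C(n, i)%:R.
  rewrite (@exprD1n_widen _ 'X n (n + i).+1) ?ltnS ?leq_addr// coef_sum.
  have lt_i : (i < (n + i).+1)%N by rewrite ltnS leq_addl.
  rewrite (bigD1 (Ordinal lt_i)) //= big1 => [|j /negPf ne_ji].
    by rewrite addr0 coefMn coefXn eqxx.
  rewrite coefMn coefXn; case: eqP => [ij|]; last by rewrite mul0rn.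
  by case/eqP: ne_ji; apply: val_inj.
elim: d => [|d <-]; first by rewrite mul0n add0n.
rewrite -!coef_binom mulSn -addnA exprD exprDn_pchar ?expr1n; last first.
  by rewrite (eq_pnat _ (pchar_poly R)) pnatX pnatE // charRp.
rewrite mulrDl mul1r coefD coefXnM ifT ?addr0 //.
by rewrite subn1 prednK.
Qed.

(** Only the remainder [y] of [x] modulo [p ^ h] matters. As [y <= p ^ h - 1], the binomial is 1 if
    [y = p ^ h - 1] and 0 otherwise. *)
Lemma bin_pchar_indicator (R : comNzRingType) (p h x : nat) :
  p \in [pchar R] -> 'C(x, p ^ h - 1)%:R = (p ^ h %| x.+1)%N%:R :> R.
Proof.
move=> charRp; have p_pr := pcharf_prime charRp.
have q_gt0: (0 < p ^ h)%N by rewrite expn_gt0 prime_gt0.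
rewrite {1}(divn_eq x (p ^ h)) bin_pchar_add // {2}(divn_eq x (p ^ h)) -addnS.
rewrite dvdn_addr ?dvdn_mull // /dvdn.
move: (ltn_pmod x q_gt0); set y := (x %% _)%N; move: (p ^ h)%N q_gt0 => q q_gt0.
rewrite leq_eqVlt => /orP[/eqP <-|lt_yq].
  by rewrite modnn subn1 binn.
by rewrite modn_small // bin_small // subn1 -ltnS prednK.
Qed.

(** * Order of vanishing at the origin and coefficient extraction *)

Section Order.

Variables (R : comNzRingType) (l : nat).
Implicit Types (P Q : {mpoly R[l]}) (m : 'X_{1..l}).

(** Membership in the [d]-th power of the ideal generated by the variables. *)
Definition mord_ge (d : nat) P := forall m, (mdeg m < d)%N -> P@_m = 0.

Lemma mord_ge_leq d e P : (e <= d)%N -> mord_ge d P -> mord_ge e P.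
Proof. by move=> le_ed Pd m lt_m; apply: Pd; apply: leq_trans lt_m le_ed. Qed.

Lemma mord_geD d P Q : mord_ge d P -> mord_ge d Q -> mord_ge d (P + Q).
Proof. by move=> Pd Qd m lt_m; rewrite mcoeffD Pd // Qd // addr0. Qed.

Lemma mord_geN d P : mord_ge d P -> mord_ge d (- P).
Proof. by move=> Pd m lt_m; rewrite mcoeffN Pd // oppr0. Qed.

Lemma mord_geM d e P Q :
  mord_ge d P -> mord_ge e Q -> mord_ge (d + e) (P * Q).
Proof.
move=> Pd Qe m lt_m; rewrite mcoeffM big1 // => -[m1 m2] /eqP def_m /=.
rewrite def_m mdegD in lt_m.
have [lt1|le1] := ltnP (mdeg m1) d; first by rewrite Pd // mul0r.
rewrite [X in _ * X]Qe ?mulr0 // -(ltn_add2l (mdeg m1)).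
by apply: leq_trans lt_m _; rewrite leq_add2r.
Qed.

(** Replacing one factor [u s] of order 1 by [v s] changes it in order 2, so the product changes
    only one order above its own. *)
Lemma mord_ge_prod (S : Type) (r : seq S) (u v : S -> {mpoly R[l]}) :
  (forall s, mord_ge 1 (v s)) -> (forall s, mord_ge 2 (u s - v s)) ->
  mord_ge (size r) (\prod_(s <- r) v s) /\
  mord_ge (size r).+1 (\prod_(s <- r) u s - \prod_(s <- r) v s).
Proof.
move=> v1 uv2; elim: r => [|s r [IHv IHuv]] /=.
  by rewrite !big_nil subrr; split=> // m _; rewrite mcoeff0.
rewrite !big_cons -add1n; split; first exact: mord_geM.
set U := \prod_(_ <- _) u _ in IHuv *; set V := \prod_(_ <- _) v _ in IHv IHuv *.
(* Writing [u s] as [v s + (u s - v s)] exhibits it as a term of order 1. *)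
have ->: u s * U - v s * V = (u s - v s) * V + (v s + (u s - v s)) * (U - V).
  by ring.
apply: mord_geD; first exact: (mord_geM 2).
rewrite -addnS; apply: mord_geM => //; apply: mord_geD => //.
exact: mord_ge_leq (uv2 s).
Qed.

Lemma mcoeff_prod_1X (e : 'I_l -> nat) m :
  (\prod_t (1 + 'X_t) ^+ e t : {mpoly R[l]})@_m = \prod_t 'C(e t, m t)%:R.
Proof.
(* [N] exceeds every [e t] and every [m t]: all factors expand over the one index type ['I_N], and
   [m] itself occurs there, as [f0]. *)
pose N := (\sum_t e t + mdeg m).+1.
have lt_e t : (e t < N)%N.
  by rewrite /N (bigD1 t) //= ltnS -!addnA leq_addr.
have lt_m t : (m t < N)%N.
  by rewrite /N ltnS mdegE [X in (_ + X)%N](bigD1 t) //= addnCA leq_addr.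
under eq_bigr => t _ do rewrite (exprD1n_widen _ 'X_t _ _ (lt_e t)).
rewrite bigA_distr_bigA raddf_sum /=.
have coef_f (f : {ffun 'I_l -> 'I_N}) :
    (\prod_t ('X_t ^+ f t *+ 'C(e t, f t)) : {mpoly R[l]})@_m =
    (\prod_t 'C(e t, f t)%:R) * ([multinom (f t : nat) | t < l] == m)%:R.
  under eq_bigr => t _ do rewrite -mulr_natl.
  rewrite big_split /= -mcoeffX mpolyXE_id -mcoeffCM rmorph_prod /=.
  congr ((_ * _)@__); apply: eq_bigr => t _; first by rewrite rmorph_nat.
  by rewrite mnmE.
under eq_bigr => f _ do rewrite coef_f.
pose f0 := [ffun t => Ordinal (lt_m t)].
rewrite (bigD1 f0) //= [X in _ + X]big1 => [|f /negPf ne_f].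
  rewrite (_ : [multinom _ | _ < _] = m); last first.
    by apply/mnmP=> t; rewrite mnmE ffunE.
  by rewrite eqxx mulr1 addr0; apply: eq_bigr => t _; rewrite ffunE.
case: eqP => [def_m|]; last by rewrite mulr0.
case/eqP: ne_f; apply/ffunP=> t; apply: val_inj.
by rewrite ffunE /= -def_m mnmE.
Qed.

(** The exponents of degree at most 1 are [0] and [U_(i)], where the product has coefficients 1 and
    [c i]. *)
Lemma mord_ge_linear_part (c : 'I_l -> nat) :
  mord_ge 2 (\prod_t (1 + 'X_t) ^+ c t - 1 - \sum_t (c t)%:R *: 'X_t).
Proof.
move=> m; rewrite !mcoeffB mcoeff_prod_1X mcoeff1 raddf_sum /=.
under [X in _ - X]eq_bigr => t _ do rewrite mcoeffZ mcoeffX.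
rewrite ltnS leq_eqVlt ltnS leqn0 => /orP[/mdeg1P[i /eqP ->]|].
  rewrite (bigD1 i) //= big1 => [|t /negPf ne_ti]; last first.
    by rewrite mnm1E eq_sym ne_ti bin0.
  rewrite mnm1E eqxx bin1 mulr1 mnm1_eq0 subr0 (bigD1 i) //= eqxx mulr1 big1.
    by rewrite addr0 subrr.
  move=> t /negPf ne_ti; case: eqP => [/mnmP/(_ t)|]; last by rewrite mulr0.
  by rewrite !mnm1E eqxx eq_sym ne_ti.
rewrite mdeg_eq0 => /eqP ->; rewrite eqxx.
rewrite big1 => [|t _]; last by rewrite mnm0E bin0.
rewrite subrr big1 ?subr0 // => t _.
by rewrite mnm1_eq0 mulr0.
Qed.

Lemma alternating_sum_prod_bin (k : nat) (a : 'I_k -> 'I_l -> nat)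
    (b : 'I_l -> nat) m :
  (mdeg m <= k)%N ->
  \sum_(I : {set 'I_k})
     (-1) ^+ #|I| * \prod_t 'C(b t + \sum_(s in I) a s t, m t)%:R =
  (-1) ^+ k * \sum_(f : {ffun 'I_k -> 'I_l} |
                      [forall t, #|f @^-1: [set t]| == m t])
                 \prod_s (a s (f s))%:R :> R.
Proof.
move=> le_mk.
pose B : {mpoly R[l]} := \prod_t (1 + 'X_t) ^+ b t.
pose Y s : {mpoly R[l]} := \prod_t (1 + 'X_t) ^+ a s t.
pose L s : {mpoly R[l]} := \sum_t (a s t)%:R *: 'X_t.
have L1 s : mord_ge 1 (- L s).
  apply: mord_geN => n; rewrite ltnS leqn0 mdeg_eq0 => /eqP ->.
  rewrite raddf_sum big1 //= => t _.
  by rewrite mcoeffZ mcoeffX mnm1_eq0 mulr0.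
have YL s : mord_ge 2 (1 - Y s - (- L s)).
  rewrite opprK -[_ + L s]opprK; apply: mord_geN.
  by rewrite opprD opprB; apply: mord_ge_linear_part.
have [prodL prodYL] := mord_ge_prod _ (index_enum 'I_k) _ _ L1 YL.
rewrite -[index_enum _]enumT size_enum_ord in prodL prodYL.
have B1 : mord_ge 1 (B - 1).
  move=> n; rewrite ltnS leqn0 mdeg_eq0 => /eqP ->.
  rewrite mcoeffB mcoeff_prod_1X mcoeff1 eqxx big1 ?subrr // => t _.
  by rewrite mnm0E bin0.
rewrite enumT in prodL prodYL.
set U := \prod_(_ <- _) (1 - Y _) in prodYL *.
set V := \prod_(_ <- _) (- L _) in prodL prodYL *.
(* Distributing [U] over the choice of [1] or [- Y s] in each factor yields the sum over subsets
   [I]. *)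
transitivity ((B * U)@_m).
  rewrite /U.
  under eq_bigr => s _ do rewrite addrC.
  rewrite bigA_distr mulr_sumr raddf_sum /=; apply: eq_bigr => I _.
  rewrite -mcoeff_prod_1X -big_mkcond /= prodrN -mulrCA.
  rewrite -[(-1) ^+ #|I| in RHS](rmorph_sign (@mpolyC l R)).
  rewrite mcoeffCM; congr (_ * _@__).
  rewrite exchange_big /= -big_split /=; apply: eq_bigr => t _.
  by rewrite exprD -expr_sum.
(* [B - 1] has order 1, [V] order [k] and [U - V] order [k.+1], so [B * U] and [V] agree up to
   degree [k]. *)
transitivity (V@_m).
  apply/eqP; rewrite -subr_eq0 -mcoeffB; apply/eqP.
  have ->: B * U - V = (B - 1) * (V + (U - V)) + (U - V).
    by ring.
  suff: mord_ge k.+1 ((B - 1) * (V + (U - V)) + (U - V)) by apply.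
  apply: mord_geD => //; rewrite -add1n; apply: mord_geM => //.
  by apply: mord_geD => //; apply: mord_ge_leq prodYL.
rewrite /V prodrN cardT size_enum_ord.
rewrite -[in LHS](rmorph_sign (@mpolyC l R)).
rewrite mcoeffCM bigA_distr_bigA raddf_sum /=; congr (_ * _).
rewrite [RHS]big_mkcond; apply: eq_bigr => f _.
under eq_bigr => s _ do rewrite -mul_mpolyC.
rewrite big_split /= -rmorph_prod mcoeffCM.
rewrite -(big_morph _ (@mpolyXD l R) (@mpolyX0 l R)) mcoeffX.
rewrite (_ : (_ == m) = [forall t, #|f @^-1: [set t]| == m t]).
  by case: ifP => _; rewrite ?mulr1 ?mulr0.
(* The monomial picked by a map [f] has the fibre sizes of [f] as exponents. *)
have Ef t : (\sum_s U_(f s))%MM t = #|f @^-1: [set t]|.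
  rewrite mnm_sumE -sum1_card [RHS]big_mkcond; apply: eq_bigr => s _.
  by rewrite mnm1E !inE; case: eqP.
apply/eqP/forallP => [<- t|eq_m]; first by rewrite Ef.
by apply/mnmP=> t; rewrite Ef (eqP (eq_m t)).
Qed.

End Order.

(** * Covering families and maps *)

(* The size condition forces a covering family to be a partition. *)
Lemma sum_covers_fibers (R : comNzRingType) (S T : finType) (t0 : T)
    (F : S -> T -> R) (n : T -> nat) :
  (\sum_t n t <= #|S|)%N ->
  \sum_(J : {ffun T -> {set S}} |
          (\bigcup_t J t == [set: S]) && [forall t, #|J t| == n t])
     \prod_t \prod_(s in J t) F s t =
  \sum_(f : {ffun S -> T} | [forall t, #|f @^-1: [set t]| == n t])
     \prod_s F s (f s).
Proof.
move=> le_nS.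
pose J_of (f : {ffun S -> T}) := [ffun t => f @^-1: [set t]].
(* The default [t0] is never reached on a covering family. *)
pose f_of (J : {ffun T -> {set S}}) :=
  [ffun s => odflt t0 [pick t | s \in J t]].
rewrite (reindex_onto J_of f_of) => [|J /andP[/eqP coverJ /forallP cardJ]] /=.
  apply: eq_big => [f|f _].
    rewrite (_ : f_of _ = f) ?eqxx ?andbT; last first.
      apply/ffunP=> s; rewrite ffunE.
      case: pickP => [t|/(_ (f s))]; rewrite ffunE !inE ?eqxx //.
      by move/eqP.
    rewrite (_ : _ == _); last first.
      apply/eqP/setP=> s; rewrite inE; apply/bigcupP; exists (f s) => //.
      by rewrite ffunE !inE.
    by apply: eq_forallb => t; rewrite ffunE.
  rewrite [RHS](partition_big f predT) //=; apply: eq_bigr => t _.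
  rewrite ffunE; apply: eq_big => [s|s]; first by rewrite !inE.
  by rewrite !inE => /eqP ->.
have coverP s : exists t, s \in J t.
  have: s \in \bigcup_t J t by rewrite coverJ inE.
  by case/bigcupP=> t _ ?; exists t.
(* Double counting of the pairs with [s \in J t]: there are at most [#|S|], and every [s] lies in
   some [J t], hence in exactly one. *)
have sum1 : (\sum_s #|[set t | s \in J t]| <= \sum_(s : S) 1)%N.
  rewrite sum1_card (leq_trans _ le_nS) //.
  under eq_bigr => s _ do rewrite -sum1dep_card big_mkcond.
  rewrite exchange_big /=; apply: leq_sum => t _.
  by rewrite -(eqP (cardJ t)) -sum1_card [in X in (_ <= X)%N]big_mkcond.
have ge1 s : (1 <= #|[set t | s \in J t]|)%N.
  by have [t Jt] := coverP s; apply/card_gt0P; exists t; rewrite inE.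
have eq1 s : #|[set t | s \in J t]| = 1%N.
  apply/eqP; rewrite eqn_leq ge1 andbT leqNgt; apply/negP=> gt1.
  move: sum1; rewrite leqNgt => /negP; apply.
  rewrite (bigD1 s) //= [X in (_ < X)%N](bigD1 s) //= -addSn leq_add //.
  by apply: leq_sum.
apply/ffunP=> t; apply/setP=> s; rewrite ffunE !inE ffunE.
have /eqP/cards1P[u def_u] := eq1 s.
have inJ v : (s \in J v) = (v == u) by have/setP/(_ v) := def_u; rewrite !inE.
case: pickP => [v|/(_ u)]; rewrite inJ ?eqxx // => /eqP ->.
by rewrite /= eq_sym inJ.
Qed.

(** * Natural residues and the reduction to ['F_p] *)

Definition resn (d : nat) (z : int) : nat := `|(z %% d)%Z|.

Lemma resnE (d : nat) (z : int) :
  (0 < d)%N -> (resn d z)%:Z = z - (z %/ d)%Z * d%:Z.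
Proof.
move=> d_gt0; rewrite gez0_abs ?modz_ge0 ?eqz_nat -?lt0n // {2}(divz_eq z d); ring.
Qed.
(** The successor cancels the [- 1] in [- c0 - 1]; the two dividends then differ by [e], the
    multiple of [d] discarded by the reductions. *)
Lemma resn_dvd (S : finType) (I : {set S}) (d : nat) (c : S -> int) (c0 : int) :
  (0 < d)%N ->
  (d %| (resn d (- c0 - 1) + \sum_(s in I) resn d (c s)).+1)%N =
  (d%:Z %| \sum_(s in I) c s - c0)%Z.
Proof.
move=> d_gt0; set r := _.+1.
pose e := (((- c0 - 1) %/ d)%Z + \sum_(s in I) (c s %/ d)%Z) * d%:Z.
have ->: \sum_(s in I) c s - c0 = r%:Z + e.
  rewrite /r -addn1 !PoszD (raddf_sum Posz) /=.
  under [X in _ + X + _ + _]eq_bigr => s _ do rewrite resnE //.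
  rewrite resnE // sumrB /e mulrDl mulr_suml.
  set u := _ * _; set v := \sum_(s in I) _ * _.
  by ring.
by rewrite (rpredDr _ (dvdz_mull _ (dvdzz _))).
Qed.

Theorem theorem3p2 (p k l : nat) (h : 'I_l -> nat)
    (c : 'I_k -> 'I_l -> int) (c0 : 'I_l -> int)
    (p_prime : prime p) (k_gt0 : (0 < k)%N)
    (h_gt0 : forall t : 'I_l, (0 < h t)%N)
    (k_ge : (\sum_(t < l) (p ^ h t - 1) <= k)%N) :
  (\sum_(I : {set 'I_k} |
          [forall t : 'I_l,
             ((p ^ h t)%N%:Z %| (\sum_(s in I) c s t - c0 t)%R)%Z])
      (-1 : int) ^+ #|I| =
   \sum_(J : {ffun 'I_l -> {set 'I_k}} |
          (\bigcup_(t : 'I_l) J t == [set: 'I_k]) &&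
          [forall t : 'I_l, #|J t| == (p ^ h t - 1)%N])
      \prod_(t < l) \prod_(s in J t) c s t
   %[mod p%:Z])%Z.
Proof.
have charFp := pchar_Fp p_prime.
have q_gt0 t : (0 < p ^ h t)%N by rewrite expn_gt0 prime_gt0.
apply/eqP; rewrite eqz_mod_dvd (dvdz_pcharf charFp) intrB subr_eq0; apply/eqP.
pose a s t := resn (p ^ h t) (c s t).
pose b t := resn (p ^ h t) (- c0 t - 1).
(* Since [h t > 0], a residue modulo [p ^ h t] keeps its class modulo [p]. *)
have a_Fp s t : (a s t)%:R = (c s t)%:~R :> 'F_p.
  rewrite -[(a s t)%:R]/((a s t)%:Z%:~R) resnE // intrB intrM.
  by rewrite -[(p ^ h t)%N%:Z%:~R]/((p ^ h t)%N%:R) natrX pchar_Fp_0 // expr0n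
             eqn0Ngt h_gt0 mulr0 subr0.
pose m := [multinom (p ^ h t - 1)%N | t < l].
have deg_m : mdeg m = (\sum_t (p ^ h t - 1))%N.
  by rewrite mdegE; apply: eq_bigr => t _; rewrite mnmE.
(* The product of binomials is the indicator of all the divisibility conditions. *)
transitivity (\sum_(I : {set 'I_k})
    (-1) ^+ #|I| * \prod_t 'C(b t + \sum_(s in I) a s t, m t)%:R : 'F_p).
  rewrite rmorph_sum /= big_mkcond; apply: eq_bigr => I _.
  rewrite rmorphXn rmorphN1.
  under eq_bigr => t _ do
    rewrite mnmE (bin_pchar_indicator _ _ _ _ charFp)
            (resn_dvd _ _ _ (c^~ t)) //.
  case: ifP => [/forallP dvdI|/negbT].
    by rewrite big1 ?mulr1 // => t _; rewrite dvdI.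
  rewrite negb_forall => /existsP[t /negPf ndvd].
  by rewrite (bigD1 t) //= ndvd mul0r mulr0.
rewrite alternating_sum_prod_bin ?deg_m // rmorph_sum /=.
under [RHS]eq_bigr => J _ do rewrite rmorph_prod; rewrite /=.
under [RHS]eq_bigr => J _ do under eq_bigr => t _ do
  (rewrite rmorph_prod; under eq_bigr => s _ do rewrite /= -a_Fp).
(* For [l = 0] both sums are empty, because ['I_k] is inhabited. *)
have [t0 _|noT] := pickP 'I_l; last first.
  rewrite !big1 ?mulr0 // => [J /andP[/eqP/setP/(_ (Ordinal k_gt0))]|f _].
    by rewrite inE => /bigcupP[t]; have := noT t.
  by have := noT (f (Ordinal k_gt0)).
rewrite (sum_covers_fibers _ _ _ t0 (fun s t => (a s t)%:R)) ?card_ord //.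
under [in LHS]eq_bigl => f do under eq_forallb => t do rewrite mnmE.
pose has_fibers (f : {ffun 'I_k -> 'I_l}) :=
  [forall t, #|f @^-1: [set t]| == (p ^ h t - 1)%N].
(* A map with these fibre sizes forces [k] to be their sum; without one, both sides vanish. *)
have [f /forallP card_f|no_f] := pickP has_fibers; last first.
  by rewrite !big_pred0 // mulr0.
suff ->: (-1) ^+ k = 1 :> 'F_p by rewrite mul1r.
have ->: k = (\sum_t (p ^ h t - 1))%N.
  under eq_bigr => t _ do rewrite -(eqP (card_f t)).
  rewrite -{1}(card_ord k) -sum1_card (partition_big f predT) //=.
  by apply: eq_bigr => t _; rewrite -sum1_card; apply: eq_bigl => s; rewrite !inE.
rewrite expr_sum big1 // => t _.
(* Either [-1 = 1] in ['F_p], or [p] is odd and each [p ^ h t - 1] is even. *)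
case: (even_prime p_prime) => [p2|p_odd].
  by rewrite (oppr_pchar2 _) ?expr1n // -p2.
by rewrite -signr_odd oddB ?q_gt0 // oddX p_odd orbT.
Qed.
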